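(* For integers $d\geq 1$ and $l\geq 2$, let $f_{d,l}=y^{l}+x-x^{d}z\in\mathbb{C}[x,y,z]$ and let $U_{d,l}=\mathbb{A}^{3}\setminus\{f_{d,l}=0\}=\mathrm{Spec}\big(\mathbb{C}[x,y,z]_{f_{d,l}}\big)$. Then for every fixed $l\geq 2$, the fourfolds $U_{d,l}\times\mathbb{A}^{1}$, $d\geq 1$, are all isomorphic; that is, for every $l\geq 2$ and all $d,d'\geq 1$, the algebraic varieties $U_{d,l}\times\mathbb{A}^{1}$ and $U_{d',l}\times\mathbb{A}^{1}$ over $\mathbb{C}$ are isomorphic.
   Context: All varieties are over the field $\mathbb{C}$ of complex numbers, and $\mathbb{A}^{n}$ denotes affine $n$-space over $\mathbb{C}$. For $f\in\mathbb{C}[x,y,z]$, $\mathbb{C}[x,y,z]_{f}$ denotes the localization at the powers of $f$. Isomorphism means isomorphism of complex algebraic varieties (equivalently, since all varieties here are affine, isomorphism of their coordinate rings as $\mathbb{C}$-algebras). *)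

(* Defs.v *)
From HB Require Import structures.
From mathcomp Require Import all_boot all_order all_algebra.
From mathcomp Require Import boolp reals.
From mathcomp Require Import mpoly.
From mathcomp Require Import complex.

Set Implicit Arguments.
Unset Strict Implicit.
Unset Printing Implicit Defensive.

Import GRing.Theory.
Local Open Scope ring_scope.

(* The localization K[X_0, ..., X_(n-1)]_f, i.e. the coordinate ring of the
   principal open subset A^n \ {f = 0}: since the polynomial ring is a domain,
   it is (for f != 0) the subring of the fraction field made of the g / f^k,
   with its K-algebra structure. *)
Section Localization.
Variables (K : fieldType) (n : nat) (f : {mpoly K[n]}).

Definition frac_pow : {pred {fraction {mpoly K[n]}}} :=
  fun q => `[< exists (g : {mpoly K[n]}) (k : nat),
                 q = tofrac g / tofrac f ^+ k >].

Lemma frac_pow_subring : subring_closed frac_pow.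
Proof.
split=> [|p q /asboolP[g [k ->]] /asboolP[h [m ->]]|
          p q /asboolP[g [k ->]] /asboolP[h [m ->]]]; apply/asboolP.
- by exists 1, 0%N; rewrite expr0 divr1 rmorph1.
- have [f0|f_neq0] := eqVneq (tofrac f) 0; last first.
    exists (g * f ^+ m - h * f ^+ k), (k + m)%N.
    rewrite rmorphB !rmorphM !rmorphXn /=.
    by rewrite -[- (_ / _)]mulNr addf_div ?expf_neq0 // exprD mulNr.
  exists ((if k == 0%N then g else 0) - (if m == 0%N then h else 0)), 0%N.
  rewrite f0 expr0 divr1 rmorphB /=.
  by case: k => [|k]; case: m => [|m];
    rewrite /= ?expr0 ?expr0n /= ?invr0 ?mulr0 ?divr1 ?rmorph0.
- exists (g * h), (k + m)%N.
  by rewrite rmorphM /= exprD invfM mulrACA.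
Qed.

Record localization : Type :=
  Localization { frac_of :> {fraction {mpoly K[n]}}; _ : frac_of \in frac_pow }.

HB.instance Definition _ := [isSub for frac_of].
HB.instance Definition _ := [Choice of localization by <:].
HB.instance Definition _ :=
  GRing.SubChoice_isSubComNzRing.Build _ frac_pow localization frac_pow_subring.

Lemma localization_scale_subproof (a : K) (q : localization) :
  tofrac (mpolyC n a) * val q \in frac_pow.
Proof.
case: frac_pow_subring => _ _ fracM; apply: fracM (valP q).
by apply/asboolP; exists (mpolyC n a), 0%N; rewrite expr0 divr1.
Qed.

Definition localization_scale (a : K) (q : localization) : localization :=
  Localization (localization_scale_subproof a q).

Fact val_localization_scale a q :
  val (localization_scale a q) = tofrac (mpolyC n a) * val q.
Proof. exact: SubK. Qed.

Fact localization_scalerA a b q :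
  localization_scale a (localization_scale b q) = localization_scale (a * b) q.
Proof. by apply: val_inj; rewrite !val_localization_scale mpolyCM rmorphM /= mulrA. Qed.

Fact localization_scale1r : left_id 1 localization_scale.
Proof. by move=> q; apply: val_inj; rewrite val_localization_scale mpolyC1 rmorph1 mul1r. Qed.

Fact localization_scalerDr : right_distributive localization_scale +%R.
Proof. by move=> a p q; apply: val_inj; exact: mulrDr. Qed.

Fact localization_scalerDl q :
  {morph localization_scale^~ q : a b / a + b}.
Proof.
move=> a b; apply: val_inj.
by rewrite val_localization_scale mpolyCD rmorphD mulrDl.
Qed.

HB.instance Definition _ := GRing.Zmodule_isLmodule.Build K localization
  localization_scalerA localization_scale1r localization_scalerDr
  localization_scalerDl.

Fact localization_scalerAl (a : K) (p q : localization) :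
  a *: (p * q) = (a *: p) * q.
Proof. by apply: val_inj; exact: mulrA. Qed.

HB.instance Definition _ :=
  GRing.Lmodule_isLalgebra.Build K localization localization_scalerAl.
HB.instance Definition _ := GRing.Lalgebra_isComAlgebra.Build K localization.

End Localization.

(* The coordinate ring of X x A^1, for X affine with coordinate ring B: the
   polynomial ring B[T], as a K-algebra.  The alias is needed because {poly B}
   is canonically an algebra over B rather than over K. *)
Section Cylinder.
Variables (K : fieldType) (B : comAlgType K).

Definition cylinder : Type := {poly B}.

HB.instance Definition _ := GRing.ComNzRing.on cylinder.

Definition cylinder_scale (a : K) (p : cylinder) : cylinder :=
  (a%:A : B) *: (p : {poly B}).

Fact cylinder_scalerA a b p :
  cylinder_scale a (cylinder_scale b p) = cylinder_scale (a * b) p.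
Proof. by rewrite /cylinder_scale scalerA -scalerAl mul1r scalerA. Qed.

Fact cylinder_scale1r : left_id 1 cylinder_scale.
Proof. by move=> p; rewrite /cylinder_scale !scale1r. Qed.

Fact cylinder_scalerDr : right_distributive cylinder_scale +%R.
Proof. by move=> a p q; exact: scalerDr. Qed.

Fact cylinder_scalerDl p : {morph cylinder_scale^~ p : a b / a + b}.
Proof. by move=> a b; rewrite /cylinder_scale !scalerDl. Qed.

HB.instance Definition _ := GRing.Zmodule_isLmodule.Build K cylinder
  cylinder_scalerA cylinder_scale1r cylinder_scalerDr cylinder_scalerDl.

Fact cylinder_scalerAl (a : K) (p q : cylinder) : a *: (p * q) = (a *: p) * q.
Proof. exact: (@scalerAl _ {poly B}). Qed.

HB.instance Definition _ :=
  GRing.Lmodule_isLalgebra.Build K cylinder cylinder_scalerAl.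
HB.instance Definition _ := GRing.Lalgebra_isComAlgebra.Build K cylinder.

End Cylinder.

(* Affine varieties are isomorphic iff their coordinate rings are isomorphic as
   algebras over the base field. *)
Definition alg_isomorphic (K : fieldType) (A B : comAlgType K) : Prop :=
  exists phi : {lrmorphism A -> B}, bijective phi.

(* The field C is R[i]; the coordinates x, y, z are 'X_0, 'X_1, 'X_2. *)
Definition f_dl (R : realType) (d l : nat) : {mpoly R[i][3]} :=
  'X_1 ^+ l + 'X_0 - 'X_0 ^+ d * 'X_2.

(* The coordinate ring of the affine variety U_{d,l} = A^3 \ {f_{d,l} = 0}. *)
Definition U_dl (R : realType) (d l : nat) : comAlgType R[i] :=
  localization (f_dl R d l).

(* Main.v *)
(* Danielewski's fibre product trick.  Seen as {x^d z = y^l + x - u, u <> 0},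
   the threefold U_{d,l} is a G_a-torsor over an algebraic space S which does not
   depend on d: the (x, u)-plane minus {u = 0}, with the line {x = 0} replaced by
   its l-fold cover {y^l = u}.  As U_{1,l} and U_{d,l} are affine, the torsor
   U_{1,l} x_S U_{d,l} is trivial over both, hence isomorphic to both cylinders.
   Explicitly, from the point (x, y, z, t) of U_{d,l} x A^1 one gets the first
   coordinates (x, y + x t) on U_{1,l}; in the other direction (x, y, z, t) is sent
   to (x, g + x^d t), where g is a Hensel lift modulo x^d of the simple root y of
   Y^l + x - u modulo x.  The remaining coordinates, and the fact that the two maps
   are inverse to each other, follow by division by powers of x. *)

Require Import Defs.
From HB Require Import structures.
From mathcomp Require Import all_boot all_order all_algebra ring.
From mathcomp Require Import boolp reals mpoly complex.

Set Implicit Arguments.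
Unset Strict Implicit.
Unset Printing Implicit Defensive.

Import GRing.Theory.
Local Open Scope ring_scope.

(** * Hensel lifting modulo powers of an element of a commutative ring *)

Section Hensel.
Variable C : comNzRingType.
Implicit Types (p : {poly C}) (x y g e s : C).

Lemma horner_taylor2 p y h :
  exists r, p.[y + h] = p.[y] + p^`().[y] * h + h ^+ 2 * r.
Proof.
elim/poly_ind: p => [|p c [r IH]].
  by exists 0; rewrite deriv0 !horner0; ring.
exists (p^`().[y] + (y + h) * r).
rewrite !derivD derivM derivX derivC !hornerE IH; ring.
Qed.

(** Newton iteration, with the fixed [e] in place of the inverse of the derivative: it inverts the
    derivative only modulo [x], which is enough to gain one power of [x] at each step. *)
Lemma hensel_lift p x y c e s n :
    p.[y] = x * c -> p^`().[y] * e = 1 + x * s ->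
  exists g a b, g = y + x * a /\ p.[g] = x ^+ n.+1 * b.
Proof.
move=> py dpy; elim: n => [|n [g [a [b [gE pg]]]]].
  by exists y, 0, c; rewrite expr1; split=> //; ring.
(* Since [g] is congruent to [y] modulo [x], the same [e] still inverts the derivative at [g] modulo
   [x]. *)
have [r dpg] : exists r, p^`().[g] * e = 1 + x * r.
  have [r] := horner_taylor2 p^`() y (x * a).
  rewrite -gE => ->; exists (s + p^`()^`().[y] * a * e + x * a ^+ 2 * r * e).
  by rewrite !mulrDl dpy; ring.
have [q pgh] := horner_taylor2 p g (- (x ^+ n.+1 * b * e)).
exists (g - x ^+ n.+1 * b * e), (a - x ^+ n * b * e).
exists (- (r * b) + x ^+ n * b ^+ 2 * e ^+ 2 * q); split.
  by rewrite gE exprS; ring.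
rewrite pgh pg.
have -> : p^`().[g] * - (x ^+ n.+1 * b * e) = - (x ^+ n.+1 * b) * (p^`().[g] * e).
  by ring.
by rewrite dpg !exprS; ring.
Qed.

(** The order of vanishing of [g - y] is raised one power of [x] at a time. Every quotient is
    written out, so [x] may be a zero divisor. *)
Lemma hensel_unique p x y g a b c e s n :
    g = y + x * a -> p^`().[y] * e = 1 + x * s ->
    p.[g] = x ^+ n.+1 * b -> p.[y] = x ^+ n.+1 * c ->
  exists t, g = y + x ^+ n.+1 * t.
Proof.
move=> gE dpy pg py.
suff: forall k, (k <= n)%N -> exists t, g = y + x ^+ k.+1 * t by apply.
elim=> [|k IHk] lekn; first by exists a; rewrite expr1.
have [t gEk] := IHk (ltnW lekn).
have [r] := horner_taylor2 p y (x ^+ k.+1 * t); rewrite -gEk pg py => pgy.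
have nE : x ^+ n.+1 = x ^+ k.+2 * x ^+ (n.+1 - k.+2) by rewrite -exprD subnKC.
exists (x ^+ (n.+1 - k.+2) * (b - c) * e - t * s - x ^+ k * t ^+ 2 * r * e).
(* Multiplying the Taylor expansion by [e] turns its linear coefficient into [1 + x * s], so
   [x ^+ k.+1 * t] equals a sum of terms divisible by [x ^+ k.+2]. *)
have : (x ^+ n.+1 * (b - c)) * e
    = (x ^+ k.+1 * t) * (p^`().[y] * e) + (x ^+ k.+1 * t) ^+ 2 * r * e.
  by rewrite mulrBr pgy; ring.
rewrite dpy nE => eqn; rewrite gEk; congr (_ + _).
have -> : x ^+ k.+1 * t = x ^+ k.+2 * x ^+ (n.+1 - k.+2) * (b - c) * e
   - x ^+ k.+1 * t * (x * s) - (x ^+ k.+1 * t) ^+ 2 * r * e.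
  by rewrite eqn; ring.
by rewrite !exprS; ring.
Qed.

Lemma horner_factor p y h :
  exists q, p.[y + h] = p.[y] + h * q.
Proof.
have [r ->] := horner_taylor2 p y h.
by exists (p^`().[y] + h * r); rewrite mulrDr mulrA -expr2 [h * _]mulrC addrA.
Qed.

End Hensel.

(** * Universal property of the localized polynomial ring *)

Section Localization.
Variables (K : fieldType) (n : nat) (f : {mpoly K[n]}).

Lemma loc_subproof (p : {mpoly K[n]}) : tofrac p \in frac_pow f.
Proof. by apply/asboolP; exists p, 0%N; rewrite expr0 divr1. Qed.

Definition loc (p : {mpoly K[n]}) : localization f :=
  Localization (loc_subproof p).

Fact loc_zmod_morphism : zmod_morphism loc.
Proof. by move=> p q; apply: val_inj; rewrite /= rmorphB. Qed.

Fact loc_monoid_morphism : monoid_morphism loc.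
Proof.
by split=> [|p q]; apply: val_inj; rewrite /= ?rmorph1 // rmorphM.
Qed.

Fact loc_scalable : scalable loc.
Proof.
by move=> a p; apply: val_inj; rewrite val_localization_scale /= -mul_mpolyC rmorphM.
Qed.

HB.instance Definition _ := GRing.isZmodMorphism.Build _ _ loc loc_zmod_morphism.
HB.instance Definition _ :=
  GRing.isMonoidMorphism.Build _ _ loc loc_monoid_morphism.
HB.instance Definition _ := GRing.isScalable.Build K _ _ _ loc loc_scalable.

Hypothesis f_neq0 : f != 0.

Lemma loc_inj : injective loc.
Proof. by move=> p q /(congr1 val) /= /eqP; rewrite tofrac_eq => /eqP. Qed.

Lemma loc_unit : exists v, loc f * v = 1.
Proof.
have vP : 1 / tofrac f \in frac_pow f.
  by apply/asboolP; exists 1, 1%N; rewrite expr1 rmorph1.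
exists (Localization vP); apply: val_inj => /=.
by rewrite div1r divff // tofrac_eq0.
Qed.

Lemma loc_frac (q : localization f) : exists pk, q * loc f ^+ pk.2 = loc pk.1.
Proof.
have /asboolP[p [k qE]] := valP q; exists (p, k); apply: val_inj.
rewrite rmorphM rmorphXn /= -[frac_of q]/(val q) qE divfK //.
by rewrite expf_neq0 // tofrac_eq0.
Qed.

Lemma loc_reg (p : {mpoly K[n]}) : p != 0 -> injective (fun q => loc p * q).
Proof.
rewrite -tofrac_eq0 => p_neq0 q r /(congr1 val) eq_qr.
by apply: val_inj; apply: (mulfI p_neq0).
Qed.

Section Universal.
Variables (B : comAlgType K) (ev : {lrmorphism {mpoly K[n]} -> B}) (u : B).
Hypothesis evf_unit : ev f * u = 1.

(** The numerator and the exponent come from an arbitrary choice; [loc_liftE] shows that the value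
    does not depend on it. *)
Definition loc_lift (q : localization f) : B :=
  ev (projT1 (cid (loc_frac q))).1 * u ^+ (projT1 (cid (loc_frac q))).2.

(** Two presentations of [q] cross-multiply to an equality of polynomials because [loc] is
    injective; after [ev], the powers of [f] are cancelled by means of [u]. *)
Lemma loc_liftE q p k : q * loc f ^+ k = loc p -> loc_lift q = ev p * u ^+ k.
Proof.
rewrite /loc_lift; case: cid => -[p' k'] /= qE' qE.
have /loc_inj eq_p : loc (p' * f ^+ k) = loc (p * f ^+ k').
  by rewrite !rmorphM !rmorphXn /= -qE -qE'; ring.
have := congr1 (fun p => ev p * u ^+ (k + k')) eq_p.
rewrite !rmorphM !rmorphXn /= exprD => eq_u.
have evfX m : ev f ^+ m * u ^+ m = 1 by rewrite -exprMn evf_unit expr1n.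
transitivity (ev p' * u ^+ k' * (ev f ^+ k * u ^+ k)).
  by rewrite evfX mulr1.
transitivity (ev p * u ^+ k * (ev f ^+ k' * u ^+ k')); last first.
  by rewrite evfX mulr1.
by rewrite mulrACA [u ^+ k' * _]mulrC eq_u; ring.
Qed.

Lemma loc_lift_loc p : loc_lift (loc p) = ev p.
Proof. by rewrite (@loc_liftE _ p 0) ?expr0 ?mulr1. Qed.

Fact loc_lift_zmod_morphism : zmod_morphism loc_lift.
Proof.
move=> q r.
have [[p k] /= qE] := loc_frac q; have [[p' k'] /= rE] := loc_frac r.
have fuX m : ev f ^+ m * u ^+ m = 1 by rewrite -exprMn evf_unit expr1n.
rewrite (loc_liftE qE) (loc_liftE rE).
rewrite (@loc_liftE _ (p * f ^+ k' - p' * f ^+ k) (k + k')); last first.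
  by rewrite rmorphB !rmorphM !rmorphXn /= -qE -rE exprD; ring.
rewrite rmorphB !rmorphM !rmorphXn /= exprD.
transitivity (ev p * u ^+ k * (ev f ^+ k' * u ^+ k')
  - ev p' * u ^+ k' * (ev f ^+ k * u ^+ k)); first by ring.
by rewrite !fuX !mulr1.
Qed.

Fact loc_lift_monoid_morphism : monoid_morphism loc_lift.
Proof.
split=> [|q r]; first by rewrite -(rmorph1 loc) loc_lift_loc rmorph1.
have [[p k] /= qE] := loc_frac q; have [[p' k'] /= rE] := loc_frac r.
rewrite (loc_liftE qE) (loc_liftE rE) (@loc_liftE _ (p * p') (k + k')).
  by rewrite rmorphM exprD; ring.
by rewrite rmorphM /= -qE -rE exprD; ring.
Qed.

Fact loc_lift_scalable : scalable loc_lift.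
Proof.
move=> a q; have [[p k] /= qE] := loc_frac q.
rewrite (loc_liftE qE) (@loc_liftE _ (a *: p) k) ?linearZ ?scalerAl //=.
by rewrite -scalerAl qE.
Qed.

End Universal.

Lemma localization_lift (B : comAlgType K) (h : 'I_n -> B) (u : B) :
    mmap (in_alg B) h f * u = 1 ->
  exists phi : {lrmorphism localization f -> B}, forall i, phi (loc 'X_i) = h i.
Proof.
move=> hfu.
pose ev : {lrmorphism {mpoly K[n]} -> B} := HB.pack (mmap (in_alg B) h)
  (GRing.isScalable.Build K _ _ _ (mmap (in_alg B) h)
     (fun a p => etrans (mmapZ h (in_alg B) a p) (mulr_algl _ _))).
pose phi : {lrmorphism localization f -> B} := HB.pack (loc_lift ev u)
  (GRing.isZmodMorphism.Build _ _ _ (loc_lift_zmod_morphism (ev := ev) hfu))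
  (GRing.isMonoidMorphism.Build _ _ _ (loc_lift_monoid_morphism (ev := ev) hfu))
  (GRing.isScalable.Build K _ _ _ _ (loc_lift_scalable (ev := ev) hfu)).
exists phi => i.
by rewrite /phi/= (loc_lift_loc (ev := ev) hfu) /= mmapX mmap1U.
Qed.

Lemma lrmorphism_mpolyE (B : comAlgType K) (phi : {lrmorphism {mpoly K[n]} -> B}) p :
  phi p = mmap (in_alg B) (fun i => phi 'X_i) p.
Proof.
rewrite [p in LHS]mpolyE linear_sum; apply: eq_bigr => m _.
rewrite linearZ /= mpolyXE_id rmorph_prod mulr_algl; congr (_ *: _).
by apply: eq_bigr => i _; rewrite rmorphXn.
Qed.

(** Agreement on the variables gives agreement on polynomials, and then on the inverse of [f], since
    inverses are unique. *)
Lemma localization_lift_unique (B : comAlgType K)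
    (phi psi : {lrmorphism localization f -> B}) :
  (forall i, phi (loc 'X_i) = psi (loc 'X_i)) -> phi =1 psi.
Proof.
move=> eqX.
have eq_loc p : phi (loc p) = psi (loc p).
  rewrite [LHS](lrmorphism_mpolyE (phi \o loc) p).
  rewrite [RHS](lrmorphism_mpolyE (psi \o loc) p).
  by congr mmap; apply: funext.
move=> q; have [[p k] /= qE] := loc_frac q; have [v fv] := loc_unit.
have fvk : loc f ^+ k * v ^+ k = 1 by rewrite -exprMn fv expr1n.
rewrite -[q]mulr1 -fvk mulrA qE !rmorphM !rmorphXn /= eq_loc; congr (_ * _ ^+ k).
have fv_phi : psi (loc f) * phi v = 1 by rewrite -eq_loc -rmorphM fv rmorph1.
have fv_psi : psi (loc f) * psi v = 1 by rewrite -rmorphM fv rmorph1.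
by rewrite -[RHS]mulr1 -fv_phi [RHS]mulrCA mulrA fv_psi mul1r.
Qed.

End Localization.

(** * Universal property of the cylinder *)

Section Cylinder.
Variables (K : fieldType) (A : comAlgType K).

Definition cylC (a : A) : cylinder A := a%:P.
Definition cylT : cylinder A := 'X.

Fact cylC_zmod_morphism : zmod_morphism cylC.
Proof. exact: (rmorphB (@polyC A)). Qed.

Fact cylC_monoid_morphism : monoid_morphism cylC.
Proof. by split; [exact: polyC1 | exact: polyCM]. Qed.

Fact cylC_scalable : scalable cylC.
Proof.
by move=> a b; rewrite /cylC -[a *: b]mulr_algl polyCM mul_polyC.
Qed.

HB.instance Definition _ := GRing.isZmodMorphism.Build _ _ cylC cylC_zmod_morphism.
HB.instance Definition _ :=
  GRing.isMonoidMorphism.Build _ _ cylC cylC_monoid_morphism.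
HB.instance Definition _ := GRing.isScalable.Build K _ _ _ cylC cylC_scalable.

Lemma cylC_reg (a : A) :
  injective (fun b => a * b) -> injective (fun p => cylC a * p).
Proof.
move=> a_reg p q /= eq_ap; apply/polyP => i; apply: a_reg.
have := congr1 (fun p : {poly A} => p`_i) eq_ap.
by rewrite /cylC !coefCM.
Qed.

Lemma cylinder_lift (B : comAlgType K) (phi : {lrmorphism A -> B}) (t : B) :
  exists Phi : {lrmorphism cylinder A -> B},
    (forall a, Phi (cylC a) = phi a) /\ Phi cylT = t.
Proof.
have phit : commr_rmorph phi t by move=> a; exact: mulrC.
have PhiZ : scalable (horner_morph phit : cylinder A -> B).
  move=> a p; rewrite -[a *: p]/(a%:A *: (p : {poly A})) -mul_polyC.
  rewrite rmorphM /= horner_morphC.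
  exact: etrans (congr1 (fun b => b * _) (rmorph_alg phi a)) (mulr_algl _ _).
pose Phi : {lrmorphism cylinder A -> B} :=
  HB.pack (horner_morph phit : cylinder A -> B)
  (GRing.isZmodMorphism.Build _ _ (horner_morph phit : cylinder A -> B)
     (rmorphB (horner_morph phit)))
  (GRing.isMonoidMorphism.Build _ _ (horner_morph phit : cylinder A -> B)
     (rmorphism_monoidP (horner_morph phit)))
  (GRing.isScalable.Build K _ _ _ (horner_morph phit : cylinder A -> B) PhiZ).
exists Phi; split=> [a|]; first exact: horner_morphC.
exact: horner_morphX.
Qed.

Lemma cylinder_lift_unique (B : comAlgType K)
    (phi psi : {lrmorphism cylinder A -> B}) :
  phi \o cylC =1 psi \o cylC -> phi cylT = psi cylT -> phi =1 psi.
Proof.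
(* Stating the predicate on [{poly A}] lets polynomial induction see through the alias
   [cylinder]. *)
move=> eqC eqT p; pose P (q : {poly A}) := phi q = psi q.
suff: P p by []; elim/poly_ind: (p : {poly A}) => [|q c IH]; rewrite /P.
  by rewrite (rmorph0 phi) (rmorph0 psi).
rewrite (rmorphD phi) (rmorphD psi) (rmorphM phi) (rmorphM psi).
by congr (_ * _ + _); [exact: IH | exact: eqT | exact: eqC].
Qed.

End Cylinder.

(** * Isomorphism between the cylinders for the exponents 1 and [n.+1] *)

Section StableIso.
Variables (K : fieldType) (l : nat).
Hypothesis l_neq0 : l%:R != 0 :> K.

Definition fpoly (d : nat) : {mpoly K[3]} := 'X_1 ^+ l + 'X_0 - 'X_0 ^+ d * 'X_2.

Local Notation A d := (localization (fpoly d)).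
Local Notation coord d i := (loc (fpoly d) 'X_i).

Lemma l_gt0 : (0 < l)%N.
Proof. by case: l l_neq0; rewrite ?eqxx. Qed.

Lemma fpoly_neq0 d : fpoly d != 0.
Proof.
(* At the point (1, 0, 0) the polynomial takes the value 1, because [l] is positive. *)
apply/eqP => /(congr1 (meval (fun i : 'I_3 => (i == 0)%:R))).
rewrite meval0 /fpoly mevalB mevalD mevalM !rmorphXn /= !mevalXU /= mulr0 subr0.
by rewrite expr0n eqn0Ngt l_gt0 add0r => /eqP; rewrite oner_eq0.
Qed.

Lemma fpoly_lift (B : comAlgType K) d (x y z u : B) :
    (y ^+ l + x - x ^+ d * z) * u = 1 ->
  exists phi : {lrmorphism A d -> B},
    [/\ phi (coord d 0) = x, phi (coord d 1) = y & phi (coord d 2%R) = z].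
Proof.
move=> fu; pose h (i : 'I_3) := [:: x; y; z]`_i.
have [|phi phiE] := localization_lift (fpoly_neq0 d) (h := h) (u := u).
  by rewrite /fpoly rmorphB rmorphD rmorphM !rmorphXn /= !mmapX !mmap1U.
by exists phi; rewrite !phiE.
Qed.

Lemma fpoly_lift_unique (B : comAlgType K) d (phi psi : {lrmorphism A d -> B}) :
    phi (coord d 0) = psi (coord d 0) -> phi (coord d 1) = psi (coord d 1) ->
    phi (coord d 2%R) = psi (coord d 2%R) ->
  phi =1 psi.
Proof.
move=> eq0 eq1 eq2; apply: (localization_lift_unique (fpoly_neq0 d)) => i.
case: i => -[|[|[|//]]] ltin.
- by rewrite (_ : Ordinal ltin = 0) //; apply: val_inj.
- by rewrite (_ : Ordinal ltin = 1) //; apply: val_inj.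
- by rewrite (_ : Ordinal ltin = 2%R) //; apply: val_inj.
Qed.

Lemma coord_eq d : loc (fpoly d) (fpoly d)
  = coord d 1 ^+ l + coord d 0 - coord d 0 ^+ d * coord d 2%R.
Proof. by rewrite {2}/fpoly rmorphB rmorphD rmorphM !rmorphXn. Qed.

(** With u the value of f, the equation y^l + x - x^d z = u says that y is a root of this polynomial
    modulo x^d, with quotient z. *)
Definition branch (B : comAlgType K) (x u : B) : {poly B} := 'X^l + (x - u)%:P.

Lemma branchE (B : comAlgType K) (x u y : B) : (branch x u).[y] = y ^+ l + x - u.
Proof. by rewrite /branch hornerD hornerXn hornerC addrA. Qed.

(** Modulo [x] one has y^l = u, a unit with inverse [v], so the derivative l y^(l-1) has inverse y v
    / l; this is where [l] must be nonzero in [K]. *)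
Lemma branch_simple (B : comAlgType K) (x u v y c : B) :
    u * v = 1 -> (branch x u).[y] = x * c ->
  exists e s, (branch x u)^`().[y] * e = 1 + x * s.
Proof.
rewrite branchE => uv yl; exists (l%:R^-1 *: (y * v)), ((c - 1) * v).
rewrite /branch derivD derivC addr0 derivXn hornerMn hornerXn.
rewrite -scaler_nat -scalerAl -scalerAr scalerA divff // scale1r [LHS]mulrA -exprSr.
rewrite prednK ?l_gt0 //.
have -> : y ^+ l = u + x * (c - 1) by rewrite mulrBr -yl; ring.
by rewrite mulrDl uv mulrA.
Qed.

Lemma branch_morph (B B' : comAlgType K) (phi : {lrmorphism B -> B'}) x u y :
  (branch (phi x) (phi u)).[phi y] = phi (branch x u).[y].
Proof. by rewrite !branchE rmorphB rmorphD rmorphXn. Qed.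

Lemma branch_shift (B : comAlgType K) (x u y z t : B) k :
    (branch x u).[y] = x ^+ k * z ->
  exists z', (branch x u).[y + x ^+ k * t] = x ^+ k * z'.
Proof.
move=> py; have [q ->] := horner_factor (branch x u) y (x ^+ k * t).
by exists (z + t * q); rewrite py mulrDr mulrA.
Qed.

Lemma branch_unique (B : comAlgType K) (x u v y z g a b : B) n :
    u * v = 1 -> (branch x u).[y] = x ^+ n.+1 * z ->
    (branch x u).[g] = x ^+ n.+1 * b -> g = y + x * a ->
  exists t, y = g + x ^+ n.+1 * t.
Proof.
move=> uv py pg gE.
have [e [s dp]] : exists e s, (branch x u)^`().[y] * e = 1 + x * s.
  by apply: (branch_simple uv (c := x ^+ n * z)); rewrite py exprS mulrA.
have [t ->] := hensel_unique gE dp pg py.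
by exists (- t); rewrite mulrN addrK.
Qed.

Lemma branch_hensel (B : comAlgType K) (x u v y z : B) n :
    u * v = 1 -> (branch x u).[y] = x * z ->
  exists g a b, g = y + x * a /\ (branch x u).[g] = x ^+ n.+1 * b.
Proof.
by move=> uv py; have [e [s dp]] := branch_simple uv py; apply: hensel_lift py dp.
Qed.

(** Describes the coordinate ring of U_{d,l} by the functor it represents, so that the main argument
    only handles elements of abstract algebras. *)
Definition universal_solution d (A : comAlgType K) (x y z : A) : Prop :=
  [/\ exists v, (y ^+ l + x - x ^+ d * z) * v = 1,
      forall (B : comAlgType K) (x' y' z' v' : B),
        (y' ^+ l + x' - x' ^+ d * z') * v' = 1 ->
        exists phi : {lrmorphism A -> B}, [/\ phi x = x', phi y = y' & phi z = z'] &
      forall (B : comAlgType K) (phi psi : {lrmorphism A -> B}),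
        phi x = psi x -> phi y = psi y -> phi z = psi z -> phi =1 psi].

(** The universal property of [C] as the polynomial ring over [A] in the variable [t]. *)
Definition universal_cylinder (A C : comAlgType K) (c : {lrmorphism A -> C}) (t : C) :=
  (forall (B : comAlgType K) (phi : {lrmorphism A -> B}) (t' : B),
     exists Phi : {lrmorphism C -> B}, Phi \o c =1 phi /\ Phi t = t') /\
  (forall (B : comAlgType K) (Phi Psi : {lrmorphism C -> B}),
     Phi \o c =1 Psi \o c -> Phi t = Psi t -> Phi =1 Psi).

(** Both morphisms preserve x and u, and are prescribed by the images of y and of the cylinder
    variable. Regularity of x serves to check the composites: z and t are recovered from their
    multiples by powers of x. *)
Lemma universal_cylinder_iso n (A1 A2 C1 C2 : comAlgType K) (x1 y1 z1 : A1)
    (x2 y2 z2 : A2) (c1 : {lrmorphism A1 -> C1}) (c2 : {lrmorphism A2 -> C2}) t1 t2 :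
    universal_solution 1 x1 y1 z1 -> universal_solution n.+1 x2 y2 z2 ->
    universal_cylinder c1 t1 -> universal_cylinder c2 t2 ->
    injective (fun p => c1 x1 * p) -> injective (fun p => c2 x2 * p) ->
  exists (phi : {lrmorphism C1 -> C2}) (psi : {lrmorphism C2 -> C1}),
    cancel phi psi /\ cancel psi phi.
Proof.
move=> [[v1 uv1] lift1 uniq1] [[v2 uv2] lift2 uniq2] [clift1 cuniq1] [clift2 cuniq2].
move=> reg1 reg2.
have regX (C : comAlgType K) (x : C) k : injective (fun p => x * p) ->
    injective (fun p => x ^+ k * p).
  move=> regx; elim: k => [|k IHk] p q; first by rewrite /= !expr0 !mul1r.
  by rewrite /= !exprS -!mulrA => /regx/IHk.
set u1 := _ - x1 ^+ 1 * z1 in uv1; set u2 := _ - _ * z2 in uv2.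
have py1 : (branch x1 u1).[y1] = x1 * z1 by rewrite branchE /u1 expr1; ring.
have py2 : (branch x2 u2).[y2] = x2 ^+ n.+1 * z2 by rewrite branchE /u2; ring.
have [g [a [b [gE pg]]]] := branch_hensel n uv1 py1.
have pc2y2 : (branch (c2 x2) (c2 u2)).[c2 y2] = c2 x2 ^+ n.+1 * c2 z2.
  by rewrite branch_morph py2 rmorphM rmorphXn.
have pc1g : (branch (c1 x1) (c1 u1)).[c1 g] = c1 x1 ^+ n.+1 * c1 b.
  by rewrite branch_morph pg rmorphM rmorphXn.
pose y1' := c2 y2 + c2 x2 * t2.
have [z1' z1'E] : exists z, (branch (c2 x2) (c2 u2)).[y1'] = c2 x2 ^+ 1 * z.
  apply: (@branch_shift _ _ _ _ (c2 x2 ^+ n * c2 z2) t2 1).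
  by rewrite pc2y2 exprS expr1 mulrA.
have u1'E : y1' ^+ l + c2 x2 - c2 x2 ^+ 1 * z1' = c2 u2.
  by rewrite -z1'E branchE; ring.
have [|phi0 [phi0x phi0y phi0z]] := lift1 _ (c2 x2) y1' z1' (c2 v2).
  by rewrite u1'E -rmorphM uv2 rmorph1.
have phi0u : phi0 u1 = c2 u2.
  by rewrite rmorphB rmorphD rmorphM !rmorphXn /= phi0x phi0y phi0z.
(* The future image of [t1]. Both [c2 y2] and [phi0 g] are roots modulo the power [n.+1] of x, and
   both are congruent to [y1'] modulo x, so uniqueness of the lift applies. *)
have [t1' t1'E] : exists t, c2 y2 = phi0 g + c2 x2 ^+ n.+1 * t.
  apply: (branch_unique (v := c2 v2) (a := t2 + phi0 a) (b := phi0 b) _ pc2y2).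
  - by rewrite -rmorphM uv2 rmorph1.
  - by rewrite -phi0x -phi0u branch_morph pg rmorphM rmorphXn.
  by rewrite gE rmorphD rmorphM /= phi0x phi0y /y1'; ring.
have [phi [phiC phiT]] := clift1 _ phi0 t1'.
pose y2' := c1 g + c1 x1 ^+ n.+1 * t1.
have [z2' z2'E] : exists z, (branch (c1 x1) (c1 u1)).[y2'] = c1 x1 ^+ n.+1 * z.
  exact: branch_shift pc1g.
have u2'E : y2' ^+ l + c1 x1 - c1 x1 ^+ n.+1 * z2' = c1 u1.
  by rewrite -z2'E branchE; ring.
(* The future image of [t2], chosen so that [y1'] will be sent back to [c1 y1]; here [g] is y1 plus
   x times [a]. *)
have [t2' t2'E] : exists t, c1 y1 = y2' + c1 x1 * t.
  exists (- c1 a - c1 x1 ^+ n * t1).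
  by rewrite /y2' gE rmorphD rmorphM exprS; ring.
have [|psi0 [psi0x psi0y psi0z]] := lift2 _ (c1 x1) y2' z2' (c1 v1).
  by rewrite u2'E -rmorphM uv1 rmorph1.
have psi0u : psi0 u2 = c1 u1.
  by rewrite rmorphB rmorphD rmorphM !rmorphXn /= psi0x psi0y psi0z.
have [psi [psiC psiT]] := clift2 _ psi0 t2'.
have psi_c2 q : psi (c2 q) = psi0 q := psiC q.
have phi_c1 q : phi (c1 q) = phi0 q := phiC q.
have psi_y1' : psi y1' = c1 y1.
  by rewrite rmorphD rmorphM /= !psi_c2 psi0x psi0y psiT t2'E.
have phi_y2' : phi y2' = c2 y2.
  by rewrite rmorphD rmorphM rmorphXn /= !phi_c1 phi0x phiT t1'E.
have psi_phi0 : psi \o phi0 =1 c1.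
  apply: uniq1 => /=.
  - by rewrite phi0x psi_c2 psi0x.
  - by rewrite phi0y psi_y1'.
  (* The product x z is the value of [branch] at y, so it suffices to compare after multiplication
     by x. *)
  apply: reg1 => /=; rewrite phi0z -[in LHS]psi0x -psi_c2 -rmorphM /=.
  rewrite -[c2 x2]expr1 -z1'E -branch_morph psi_y1' !psi_c2 psi0x psi0u.
  by rewrite branch_morph py1 rmorphM.
have phi_psi0 : phi \o psi0 =1 c2.
  apply: uniq2 => /=.
  - by rewrite psi0x phi_c1 phi0x.
  - by rewrite psi0y phi_y2'.
  apply: (regX _ _ n.+1 reg2) => /=.
  rewrite psi0z -[in LHS]phi0x -phi_c1 -rmorphXn -rmorphM /=.
  by rewrite -z2'E -branch_morph phi_y2' !phi_c1 phi0x phi0u.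
exists phi, psi; split.
- apply: (cuniq1 _ (psi \o phi) idfun) => [q|] /=.
    by rewrite phi_c1; exact: psi_phi0.
  apply: (regX _ _ n.+1 reg1) => /=.
  rewrite phiT -[in LHS]psi0x -psi_c2 -rmorphXn -rmorphM /=.
  (* Adding the image of [g] turns both sides into [y2']. *)
  apply: (addrI (psi (phi0 g))); rewrite -rmorphD /= -t1'E psi_c2 psi0y.
  by rewrite [psi _]psi_phi0.
apply: (cuniq2 _ (phi \o psi) idfun) => [q|] /=.
  by rewrite psi_c2; exact: phi_psi0.
apply: reg2 => /=; rewrite psiT -[in LHS]phi0x -phi_c1 -rmorphM /=.
apply: (addrI (phi y2')); rewrite -rmorphD /= -t2'E phi_c1 phi0y.
by rewrite phi_y2'.
Qed.

Lemma fpoly_universal d :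
  universal_solution d (coord d 0) (coord d 1) (coord d 2%R).
Proof.
split=> [|B|B]; last 2 first.
- exact: (@fpoly_lift B d).
- exact: (@fpoly_lift_unique B d).
by rewrite -coord_eq; apply: loc_unit; apply: fpoly_neq0.
Qed.

Lemma cylinder_universal (A : comAlgType K) :
  universal_cylinder (@cylC K A) (cylT A).
Proof. by split; [exact: cylinder_lift | exact: cylinder_lift_unique]. Qed.

Lemma coord0_reg d : injective (fun p : cylinder (A d) => cylC (coord d 0) * p).
Proof.
apply: cylC_reg; apply: loc_reg.
by apply/eqP => /(congr1 (mmeasure (@mdeg 3))); rewrite msizeX msize0.
Qed.

Lemma cylinder_fpoly_iso n :
  exists (phi : {lrmorphism cylinder (A 1) -> cylinder (A n.+1)})
         (psi : {lrmorphism cylinder (A n.+1) -> cylinder (A 1)}),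
    cancel phi psi /\ cancel psi phi.
Proof.
apply: (universal_cylinder_iso (fpoly_universal 1) (fpoly_universal n.+1)
  (cylinder_universal _) (cylinder_universal _)); exact: coord0_reg.
Qed.

End StableIso.

(** Used with [A] the cylinder for exponent 1, through which two arbitrary exponents are
    compared. *)
Lemma alg_isomorphic_common (K : fieldType) (A B C : comAlgType K)
    (phi : {lrmorphism A -> B}) (psi : {lrmorphism B -> A})
    (phi' : {lrmorphism A -> C}) (psi' : {lrmorphism C -> A}) :
    cancel phi psi -> cancel psi phi -> cancel phi' psi' -> cancel psi' phi' ->
  alg_isomorphic B C.
Proof.
move=> phiK psiK phiK' psiK'.
exists (phi' \o psi); exists (phi \o psi') => q /=.
  by rewrite phiK' psiK.
by rewrite phiK psiK'.
Qed.

Theorem theorem1 (R : realType) (l : nat) (hl : (2 <= l)%N)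
    (d d' : nat) (hd : (1 <= d)%N) (hd' : (1 <= d')%N) :
  alg_isomorphic (cylinder (U_dl R d l)) (cylinder (U_dl R d' l)).
Proof.
(* The base field has characteristic 0. *)
have l_neq0 : l%:R != 0 :> R[i] by rewrite Num.Theory.pnatr_eq0 -lt0n ltnW.
case: d d' hd hd' => [|n] // [|n'] // _ _.
have [phi [psi [phiK psiK]]] := cylinder_fpoly_iso l_neq0 n.
have [phi' [psi' [phiK' psiK']]] := cylinder_fpoly_iso l_neq0 n'.
exact: alg_isomorphic_common phiK psiK phiK' psiK'.
Qed.
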